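(* Let $p\ge 1$ and $j\ge 1$ be integers, let $A_j=\{1=a_1<a_2<\dots<a_j\}$ be a basis such that, with $a_0=0$, $$\{a_i \bmod p : 0\le i\le j\}=\{0,1,2,\dots,p-1\},$$ and for $m\ge 0$ let $A_{j+m}=\{1,a_2,\dots,a_j=b_0,b_1,\dots,b_m\}$ where $b_i=b_{i-1}+p$ for $i\ge 1$. If $A_{j+k}$ is admissible for some integer $k\ge 0$ such that $b_k<2b_0\le b_{k+1}$, then $A_j$ is $p$-extensible.
   Context: A basis is a finite set of positive integers $A_k=\{1=a_1<a_2<\dots<a_k\}$; by convention $a_0=0$. The range $n(A_k)$ is the largest integer $n$ such that every positive integer not exceeding $n$ can be written as $a_i+a_j$ with $0\le i,j\le k$ (repetition allowed). The basis $A_k$ is admissible if $n(A_k)\ge a_k$. A basis $A_j$ is $p$-extensible if, with $b_0=a_j$ and $b_i=b_{i-1}+p$ for $i\ge1$, the basis $A_{j+m}=\{1,a_2,\dots,a_j=b_0,b_1,\dots,b_m\}$ is admissible for every $m\ge 0$. *)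

(* Defs.v *)
From mathcomp Require Import all_boot.

Set Implicit Arguments.
Unset Strict Implicit.
Unset Printing Implicit Defensive.

(* A basis {1 = a_1 < ... < a_k} is the increasing list [:: a_1; ...; a_k] of
   its elements; k = size A, a_k = last 0 A, and a_i = nth 0 (0 :: A) i for
   0 <= i <= k, which includes the convention a_0 = 0.  The default value 0 of
   head makes the empty list not a basis. *)
Definition is_basis (A : seq nat) : bool := (head 0 A == 1) && sorted ltn A.

Definition representable (A : seq nat) (x : nat) : bool :=
  x \in [seq a + b | a <- 0 :: A, b <- 0 :: A].

Definition covers (A : seq nat) (n : nat) : bool :=
  all (representable A) (iota 1 n).

Lemma covers0 (A : seq nat) : exists n, covers A n.
Proof. by exists 0. Qed.

Lemma covers_bound (A : seq nat) (n : nat) :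
  covers A n -> n <= (\max_(a <- A) a).*2.
Proof.
case: n => [|n] //= /allP cov.
have /allpairsP [[a b] /= [aA bA ->]] : representable A n.+1.
  by apply: cov; rewrite mem_iota ltnS leqnn.
have le_max c : c \in 0 :: A -> c <= \max_(a <- A) a.
  by rewrite inE => /predU1P [-> //|cA]; apply: leq_bigmax_seq.
by rewrite -addnn leq_add ?le_max.
Qed.

(* n(A), the largest n such that all of 1, ..., n are representable. *)
Definition range (A : seq nat) : nat := ex_maxn (covers0 A) (@covers_bound A).

Definition admissible (A : seq nat) : bool := last 0 A <= range A.

(* b_0 = a_j and b_i = b_(i-1) + p, where a_j is the last element of A. *)
Definition ext_elt (p : nat) (A : seq nat) (i : nat) : nat :=
  iter i (fun b => b + p) (last 0 A).

(* A_(j+m) = {1, a_2, ..., a_j = b_0, b_1, ..., b_m} *)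
Definition extension (p : nat) (A : seq nat) (m : nat) : seq nat :=
  A ++ [seq ext_elt p A i | i <- iota 1 m].

Definition extensible (p : nat) (A : seq nat) : Prop :=
  forall m : nat, admissible (extension p A m).

(* Main.v *)
Require Import Defs.
From mathcomp Require Import all_boot.
From mathcomp Require Import zify.

(** Write [b_i = b_0 + i * p], where [b_0] is the largest element of [A].
    A basis is admissible exactly when it represents every positive integer up
    to its largest element, so [A] must be shown to represent [1, ..., b_m]
    once it is extended by [b_1, ..., b_m].  Let [0 < x <= b_m].

    If [x <= b_k], then [x] is a sum of two elements of the extension of length
    [k].  Both summands are at most [x <= b_m], so they already lie in the
    extension of length [m].

    If [x > b_k], the residue hypothesis gives [a] in [A] (or [a = 0]) such
    that [a + b_0] is congruent to [x] modulo [p].  Moreover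
    [a + b_0 <= 2 * b_0 <= b_k + p < x + p], so the congruence forces
    [a + b_0 <= x].  Hence [x = a + b_t] for some [t >= 0], and [b_t <= x <= b_m]
    gives [t <= m]. *)

Lemma coversP (A : seq nat) (n : nat) :
  reflect (forall x, 0 < x <= n -> representable A x) (covers A n).
Proof.
apply: (iffP allP) => cov x.
  by move=> xn; apply: cov; rewrite mem_iota; lia.
by rewrite mem_iota => xn; apply: cov; lia.
Qed.

Lemma admissibleE (A : seq nat) : admissible A = covers A (last 0 A).
Proof.
rewrite /admissible /range; case: ex_maxnP => n /coversP covn maxn.
apply/idP/idP => [le_n | /maxn //].
by apply/coversP => x x_le; apply: covn; lia.
Qed.

Lemma representableP (A : seq nat) (x : nat) :
  reflect (exists a b, [/\ a \in 0 :: A, b \in 0 :: A & x = a + b])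
          (representable A x).
Proof.
apply: (iffP allpairsP) => [[[a b] /= [aA bA ->]] | [a [b [aA bA ->]]]].
  by exists a, b.
by exists (a, b).
Qed.

Lemma ext_eltE (p : nat) (A : seq nat) (i : nat) :
  ext_elt p A i = last 0 A + i * p.
Proof. by rewrite /ext_elt; elim: i => [|i /= ->]; rewrite ?addn0 // mulSnr addnA. Qed.

Lemma last_extension (p : nat) (A : seq nat) (m : nat) :
  last 0 (extension p A m) = ext_elt p A m.
Proof.
case: m => [|m]; first by rewrite /extension cats0.
by rewrite /extension -(addn1 m) iotaD map_cat catA last_cat /= addn1.
Qed.

Lemma mem_extension (p : nat) (A : seq nat) (m x : nat) :
  reflect (x \in 0 :: A \/ exists2 i, 0 < i <= m & x = ext_elt p A i)
          (x \in 0 :: extension p A m).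
Proof.
rewrite /extension -cat_cons mem_cat.
apply: (iffP orP) => -[xA | x_ext]; [by left | right | by left | right].
  by case/mapP: x_ext => i; rewrite mem_iota => i_m ->; exists i => //; lia.
by case: x_ext => i i_m ->; apply: map_f; rewrite mem_iota; lia.
Qed.

Lemma basis_le_last (A : seq nat) (x : nat) :
  is_basis A -> x \in 0 :: A -> x <= last 0 A.
Proof.
case/andP=> _ A_sorted; rewrite inE => /predU1P [-> // | xA].
have: sorted leq A by apply: sub_sorted A_sorted => a b /ltnW.
elim/last_ind: A xA {A_sorted} => // A b _ xA.
rewrite -cats1 (sorted_pairwise leq_trans) pairwise_cat => /andP [/allrelP leAb _].
move: xA; rewrite last_cat mem_rcons inE => /predU1P [-> // | xA].
by apply: leAb; rewrite ?mem_head.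
Qed.

Lemma ext_elt_mem (p : nat) (A : seq nat) (m t : nat) :
  t <= m -> ext_elt p A t \in 0 :: extension p A m.
Proof.
move=> t_m; apply/mem_extension; case: t t_m => [_|t t_m].
  by left; rewrite /ext_elt /=; exact: mem_last.
by right; exists t.+1.
Qed.

(** Since [p] is positive, [b_i <= b_m] forces [i <= m]. *)
Lemma mem_extension_le (p : nat) (A : seq nat) (k m x : nat) : 0 < p ->
  x \in 0 :: extension p A k -> x <= ext_elt p A m ->
  x \in 0 :: extension p A m.
Proof.
move=> p_gt0 /mem_extension [xA _ | [i i_k ->]].
  by apply/mem_extension; left.
rewrite !ext_eltE leq_add2l leq_pmul2r // => i_m.
by apply/mem_extension; right; exists i; rewrite ?ext_eltE //; lia.
Qed.

(** Residues of [0 :: A] shifted by any [c] are still complete, since translation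
    permutes the residues. *)
Lemma shifted_residue (p : nat) (A : seq nat) (c x : nat) : 0 < p ->
    [seq nth 0 (0 :: A) i %% p | i <- iota 0 (size A).+1] =i iota 0 p ->
  exists2 a, a \in 0 :: A & a + c = x %[mod p].
Proof.
move=> p_gt0 res_A.
(* [c * p.-1] is congruent to [- c] modulo [p]. *)
have: (x + c * p.-1) %% p \in iota 0 p by rewrite mem_iota ltn_mod p_gt0.
rewrite -res_A => /mapP [i]; rewrite mem_iota => i_A eq_mod.
exists (nth 0 (0 :: A) i); first by apply: mem_nth.
rewrite -modnDml -eq_mod modnDml -addnA -mulnSr prednK //.
by rewrite addnC modnMDl.
Qed.

Lemma eq_mod_le (p y x : nat) :
  y < x + p -> y = x %[mod p] -> exists t, x = y + t * p.
Proof.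
move=> y_lt eq_mod.
have le_yx : y <= x.
  rewrite leqNgt; apply/negP => lt_xy.
  have: p %| y - x by rewrite -eqn_mod_dvd ?(ltnW lt_xy) //; apply/eqP.
  by move/dvdn_leq; lia.
have /dvdnP [t eq_t] : p %| x - y by rewrite -eqn_mod_dvd //; apply/eqP.
by exists t; lia.
Qed.

Theorem theorem5 (p j : nat) (A : seq nat) (hp : 1 <= p) (hj : 1 <= j)
    (hA : is_basis A) (hsize : size A = j)
    (hmod : [seq nth 0 (0 :: A) i %% p | i <- iota 0 j.+1] =i iota 0 p)
    (hk : exists k : nat,
        [/\ admissible (extension p A k),
            ext_elt p A k < 2 * ext_elt p A 0 &
            2 * ext_elt p A 0 <= ext_elt p A k.+1]) :
  extensible p A.
Proof.
subst j; case: hk => k [+ _ le_2b0] m.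
rewrite !admissibleE !last_extension => /coversP cov_k.
apply/coversP => x /andP [x_gt0 x_m]; apply/representableP.
have [x_k | k_x] := leqP x (ext_elt p A k).
  have /representableP [a [b [a_k b_k def_x]]] : representable (extension p A k) x.
    by apply: cov_k; rewrite x_gt0.
  by exists a, b; split=> //; [move: a_k | move: b_k] => /mem_extension_le;
     apply=> //; lia.
have [a aA eq_mod] := shifted_residue p A (last 0 A) x hp hmod.
have a_le := basis_le_last A a hA aA.
move: le_2b0 k_x x_m; rewrite !ext_eltE => le_2b0 k_x x_m.
have [|t def_x] := eq_mod_le p (a + last 0 A) x _ eq_mod; first by lia.
have t_m : t <= m by rewrite -(leq_pmul2r hp); lia.
exists a, (ext_elt p A t); split; last by rewrite ext_eltE addnA.
  by apply/mem_extension; left.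
exact: ext_elt_mem.
Qed.
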